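(* Let $(Y_n)_{n\in\mathbb{Z}}$ be a tower of spectra and $\phi:\mathbb{Z}\to\mathbb{Z}$ a strictly increasing map. 1. Let $N<M$ be integers and let $x\in (Y_{\phi(N)}^{\phi(N+1)})_*$ be an $(M-N)$-cycle in the gathered spectral sequence $({}^\phi\mathcal{B})$, that is, $d^i(x)=0$ for $i\in\{1,\dots,M-N\}$. Then any $\hat x\in (Y_n^{n+1})_*$ representing $x$ in $(\mathcal{T}_{\phi(N)}^{\phi(N+1)})$ (so that $\phi(N)\le n<\phi(N+1)$) is such that $d^{m-n}(\hat x)=0$ in $(\mathcal{B})$ for any $m$ with $n<m<\phi(M+1)$. 2. Let $\phi(N)\le n<\phi(N+1)<m$ be integers and let $\hat x\in (Y_n^{n+1})_*$ be an $(m-n)$-cycle in $(\mathcal{B})$. Then there exists a class $x\in (Y_{\phi(N)}^{\phi(N+1)})_*$ represented by $\hat x$ in $(\mathcal{T}_{\phi(N)}^{\phi(N+1)})$ such that $x$ is an $(M-N)$-cycle in $({}^\phi\mathcal{B})$ for any $M$ such that $\phi(N+1)<\phi(M+1)\le m$.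
   Context: Work in the stable homotopy category of spectra. Let $\cdots\to Y_{n+1}\to Y_n\to Y_{n-1}\to\cdots$ ($n\in\mathbb{Z}$) be a tower of spectra with (homotopy) limit $Y_\infty$ and (homotopy) colimit $Y_{-\infty}$. For $a\le b$ in $\mathbb{Z}\cup\{\pm\infty\}$, $Y_a^b$ is the cofiber of $Y_b\to Y_a$; for $a\le b\le c$ there are canonical cofiber sequences $Y_b^c\to Y_a^c\to Y_a^b\to\Sigma Y_b^c$, compatible with each other. Write $\Gamma_*=\pi_*(\Gamma)$ for a spectrum $\Gamma$. An unrolled exact couple consists of exact triangles with maps $i:A_{n+1}\to A_n$, $j:A_n\to E^1_n$, $k:E^1_n\to A_{n+1}$ ($k$ lowering the homotopical degree by $1$). For $r\ge1$ put $Z^r_n=k^{-1}(\operatorname{Im}(i^{r-1}:A_{n+r}\to A_{n+1}))$, $B^r_n=j(\operatorname{Ker}(i^{r-1}:A_n\to A_{n-r+1}))$, $E^r_n=Z^r_n/B^r_n$. For $x\in E^r_n$, $y\in E^r_{n+r}$ (or elements of $Z^r$ standing for their classes), one writes $d^r(x)=y$ when there are representatives $\bar x\in Z^r_n$ of $x$ and $\bar y\in Z^r_{n+r}$ of $y$ and $\alpha\in A_{n+r}$ with $k(\bar x)=i^{r-1}(\alpha)$ and $j(\alpha)=\bar y$. In this statement, ''$x$ is an $s$-cycle'' means $d^i(x)=0$ for all $1\le i\le s$. $(\mathcal{B})$: the spectral sequence with $A_n=(Y_n^\infty)_*$, $E^1_n=(Y_n^{n+1})_*$, target $(Y_{-\infty}^\infty)_*$.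 $(\mathcal{T}_a^b)$, for integers $a\le b$ (truncated spectral sequence): $A_n=(Y_n^b)_*$ for $a\le n\le b$, $A_n=0$ for $n\ge b$, $A_n=(Y_a^b)_*$ for $n\le a$; so $E^1_n=(Y_n^{n+1})_*$ for $a\le n<b$ and $0$ otherwise, with target $(Y_a^b)_*$. $({}^\phi\mathcal{B})$ (gathered spectral sequence): $A_n=(Y_{\phi(n)}^\infty)_*$, $E^1_n=(Y_{\phi(n)}^{\phi(n+1)})_*$, with maps the composites in the original tower, target $(Y_{-\infty}^\infty)_*$. Representation: an element $z\in(Y_n^{n+1})_*$ (an infinite cycle of $(\mathcal{T}_a^b)$) represents $\hat z\in(Y_a^b)_*$ in $(\mathcal{T}_a^b)$ if there is $\tilde z\in(Y_n^b)_*$ mapping to $z$ in $(Y_n^{n+1})_*$ and to $\hat z$ in $(Y_a^b)_*$. *)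

(* Defs.v *)
From HB Require Import structures.
From mathcomp Require Import all_boot all_order all_algebra.
From mathcomp Require Import constructive_ereal.

Set Implicit Arguments.
Unset Strict Implicit.
Unset Printing Implicit Defensive.

Import Order.TTheory GRing.Theory Num.Theory.
Local Open Scope ring_scope.

(** * Triangulated categories *)

Record preadditive := Preadditive {
  obj :> Type;
  hom : obj -> obj -> zmodType;
  idm : forall X, hom X X;
  comp : forall X Y Z, hom Y Z -> hom X Y -> hom X Z;
  compA : forall W X Y Z (h : hom Y Z) (g : hom X Y) (f : hom W X),
    comp h (comp g f) = comp (comp h g) f;
  comp1m : forall X Y (f : hom X Y), comp (idm Y) f = f;
  compm1 : forall X Y (f : hom X Y), comp f (idm X) = f;
  compDl : forall X Y Z (g g' : hom Y Z) (f : hom X Y),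
    comp (g + g') f = comp g f + comp g' f;
  compDr : forall X Y Z (g : hom Y Z) (f f' : hom X Y),
    comp g (f + f') = comp g f + comp g f'
}.

Notation "g '\oc' f" := (comp g f) (at level 40, left associativity).

Section Preadditive.
Variable C : preadditive.

Definition is_zero (Z : C) : Prop := idm Z = 0.

Definition is_iso (X Y : C) (f : hom X Y) : Prop :=
  exists g : hom Y X, g \oc f = idm X /\ f \oc g = idm Y.

Definition is_product (I : Type) (X : I -> C) (P : C)
    (pr : forall i, hom P (X i)) : Prop :=
  forall (W : C) (f : forall i, hom W (X i)),
    exists! h : hom W P, forall i, pr i \oc h = f i.

Definition is_coproduct (I : Type) (X : I -> C) (K : C)
    (inj : forall i, hom (X i) K) : Prop :=
  forall (W : C) (f : forall i, hom (X i) W),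
    exists! h : hom K W, forall i, h \oc inj i = f i.

End Preadditive.

(** [dist f g h] means that X -f-> Y -g-> Z -h-> susp X is a distinguished
    (i.e. cofiber) sequence. *)
Record triangulated := Triangulated {
  tcat :> preadditive;
  ex_zero : exists Z : tcat, is_zero Z;
  ex_biproduct : forall X Y : tcat, exists (B : tcat)
      (i1 : hom X B) (i2 : hom Y B) (p1 : hom B X) (p2 : hom B Y),
    [/\ p1 \oc i1 = idm X, p2 \oc i2 = idm Y
      & i1 \oc p1 + i2 \oc p2 = idm B];
  susp : tcat -> tcat;
  suspm : forall X Y : tcat, hom X Y -> hom (susp X) (susp Y);
  suspm1 : forall X : tcat, suspm (idm X) = idm (susp X);
  suspmM : forall (X Y Z : tcat) (g : hom Y Z) (f : hom X Y),
    suspm (g \oc f) = suspm g \oc suspm f;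
  suspmD : forall (X Y : tcat) (f g : hom X Y),
    suspm (f + g) = suspm f + suspm g;
  desuspm : forall X Y : tcat, hom (susp X) (susp Y) -> hom X Y;
  suspmK : forall X Y : tcat, cancel (@suspm X Y) (@desuspm X Y);
  desuspmK : forall X Y : tcat, cancel (@desuspm X Y) (@suspm X Y);
  susp_esurj : forall Y : tcat,
    exists (X : tcat) (f : hom (susp X) Y), is_iso f;
  dist : forall X Y Z : tcat, hom X Y -> hom Y Z -> hom Z (susp X) -> Prop;
  dist_iso : forall (X Y Z X' Y' Z' : tcat)
      (f : hom X Y) (g : hom Y Z) (h : hom Z (susp X))
      (f' : hom X' Y') (g' : hom Y' Z') (h' : hom Z' (susp X'))
      (a : hom X X') (b : hom Y Y') (c : hom Z Z'),
    is_iso a -> is_iso b -> is_iso c ->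
    b \oc f = f' \oc a -> c \oc g = g' \oc b -> suspm a \oc h = h' \oc c ->
    dist f g h -> dist f' g' h';
  dist_id : forall X Z : tcat, is_zero Z ->
    dist (idm X) (0 : hom X Z) (0 : hom Z (susp X));
  dist_cofiber : forall (X Y : tcat) (f : hom X Y),
    exists (Z : tcat) (g : hom Y Z) (h : hom Z (susp X)), dist f g h;
  dist_rot : forall (X Y Z : tcat)
      (f : hom X Y) (g : hom Y Z) (h : hom Z (susp X)),
    dist f g h <-> dist g h (- suspm f);
  dist_fill : forall (X Y Z X' Y' Z' : tcat)
      (f : hom X Y) (g : hom Y Z) (h : hom Z (susp X))
      (f' : hom X' Y') (g' : hom Y' Z') (h' : hom Z' (susp X'))
      (a : hom X X') (b : hom Y Y'),
    dist f g h -> dist f' g' h' -> b \oc f = f' \oc a ->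
    exists c : hom Z Z', c \oc g = g' \oc b /\ suspm a \oc h = h' \oc c;
  dist_octa : forall (X Y Z A B D : tcat) (f : hom X Y) (g : hom Y Z)
      (f1 : hom Y A) (f2 : hom A (susp X))
      (g1 : hom Z B) (g2 : hom B (susp Y))
      (h1 : hom Z D) (h2 : hom D (susp X)),
    dist f f1 f2 -> dist g g1 g2 -> dist (g \oc f) h1 h2 ->
    exists (u : hom A D) (v : hom D B),
      [/\ dist u v (suspm f1 \oc g2),
          u \oc f1 = h1 \oc g, h2 \oc u = f2,
          v \oc h1 = g1 & g2 \oc v = suspm f \oc h2]
}.

(** * Stable homotopy category *)

(** The stable homotopy category of spectra is handled through its standard
    structure: a triangulated category with products and coproducts, together
    with sphere spectra [sph t] = S^t for all integers t, which are compact
    and detect zero objects. *)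
Record stable_category := StableCategory {
  stri :> triangulated;
  ex_product : forall (I : Type) (X : I -> stri),
    exists (P : stri) (pr : forall i, hom P (X i)), is_product pr;
  ex_coproduct : forall (I : Type) (X : I -> stri),
    exists (K : stri) (inj : forall i, hom (X i) K), is_coproduct inj;
  sph : int -> stri;
  sph_susp : forall t : int, hom (sph t) (susp (sph (t - 1)));
  sph_desusp : forall t : int, hom (susp (sph (t - 1))) (sph t);
  sph_suspK : forall t : int, sph_desusp t \oc sph_susp t = idm _;
  sph_desuspK : forall t : int, sph_susp t \oc sph_desusp t = idm _;
  sph_compact : forall (t : int) (I : Type) (X : I -> stri) (K : stri)
      (inj : forall i, hom (X i) K) (f : hom (sph t) K),
    is_coproduct inj ->
    exists (s : seq I) (g : forall i, hom (sph t) (X i)),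
      f = \sum_(i <- s) inj i \oc g i;
  sph_gen : forall X : stri,
    (forall (t : int) (f : hom (sph t) X), f = 0) -> is_zero X
}.

Section Preliminaries.
Variable C : triangulated.
Implicit Types X Y Z W : C.

Lemma comp0m X Y Z (f : hom X Y) : (0 : hom Y Z) \oc f = 0.
Proof. by apply: (@addIr _ (0 \oc f)); rewrite -compDl !add0r. Qed.

Lemma compm0 X Y Z (g : hom Y Z) : g \oc (0 : hom X Y) = 0.
Proof. by apply: (@addIr _ (g \oc 0)); rewrite -compDr !add0r. Qed.

Lemma compNm X Y Z (g : hom Y Z) (f : hom X Y) : (- g) \oc f = - (g \oc f).
Proof. by apply: (@addIr _ (g \oc f)); rewrite -compDl !addNr comp0m. Qed.

Lemma compmN X Y Z (g : hom Y Z) (f : hom X Y) : g \oc (- f) = - (g \oc f).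
Proof. by apply: (@addIr _ (g \oc f)); rewrite -compDr !addNr compm0. Qed.

Lemma suspm0 X Y : suspm (0 : hom X Y) = 0.
Proof. by apply: (@addIr _ (suspm (0 : hom X Y))); rewrite -suspmD !add0r. Qed.

Lemma desuspm0 X Y : desuspm (0 : hom (susp X) (susp Y)) = 0.
Proof. by rewrite -suspm0 suspmK. Qed.

Lemma desuspmD X Y (f g : hom (susp X) (susp Y)) :
  desuspm (f + g) = desuspm f + desuspm g.
Proof. by apply: (can_inj (@suspmK _ _ _)); rewrite suspmD !desuspmK. Qed.

Lemma dist_exact X Y Z (f : hom X Y) (g : hom Y Z) (h : hom Z (susp X))
    W (y : hom W Y) : dist f g h ->
  g \oc y = 0 <-> exists x : hom W X, f \oc x = y.
Proof.
move=> Dfgh; have [O O0] := ex_zero C; split=> [gy0 | [x <-]].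
  have D1 := (dist_rot _ _ _).1 (dist_id W O0).
  have D2 := (dist_rot _ _ _).1 Dfgh.
  have sq : (0 : hom O Z) \oc (0 : hom W O) = g \oc y by rewrite gy0 comp0m.
  have [c [_]] := dist_fill D1 D2 sq.
  rewrite suspm1 compmN compm1 compNm => /oppr_inj yE.
  exists (desuspm c); apply: (can_inj (@suspmK _ _ _)).
  by rewrite suspmM desuspmK yE.
have sq : f \oc idm X = f \oc idm X by [].
have [c [cE _]] := dist_fill (dist_id X O0) Dfgh sq.
by rewrite compA -cE compm0 comp0m.
Qed.

End Preliminaries.

(** * Homotopy groups *)

Section HomotopyGroups.
Variable C : stable_category.

Definition htpy (t : int) (X : C) : zmodType := hom (sph C t) X.

Definition htpym (t : int) (X Y : C) (f : hom X Y) (x : htpy t X) : htpy t Y :=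
  f \oc x.

Lemma htpym_is_zmod_morphism t (X Y : C) (f : hom X Y) :
  zmod_morphism (@htpym t X Y f).
Proof. by move=> x y; rewrite /htpym compDr compmN. Qed.

HB.instance Definition _ t (X Y : C) (f : hom X Y) :=
  GRing.isZmodMorphism.Build (htpy t X) (htpy t Y) (@htpym t X Y f)
    (htpym_is_zmod_morphism f).

(** The map pi_t(Z) -> pi_t(susp X) = pi_(t-1)(X) induced by Z -> susp X. *)
Definition htpyd (t : int) (X Z : C) (h : hom Z (susp X)) (z : htpy t Z) :
    htpy (t - 1) X :=
  desuspm (h \oc z \oc sph_desusp C t).

Lemma htpyd_is_zmod_morphism t (X Z : C) (h : hom Z (susp X)) :
  zmod_morphism (@htpyd t X Z h).
Proof.
move=> x y; rewrite /htpyd compDr compmN compDl compNm desuspmD.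
congr (_ + _); apply: (can_inj (@suspmK _ _ _)); rewrite desuspmK.
apply: (@addIr _ (h \oc y \oc sph_desusp C t)); rewrite addNr.
by rewrite -{2}[_ \oc sph_desusp C t]desuspmK -suspmD addNr suspm0.
Qed.

HB.instance Definition _ t (X Z : C) (h : hom Z (susp X)) :=
  GRing.isZmodMorphism.Build (htpy t Z) (htpy (t - 1) X) (@htpyd t X Z h)
    (htpyd_is_zmod_morphism h).

Section LongExactSequence.
Variables (X Y Z : C) (f : hom X Y) (g : hom Y Z) (h : hom Z (susp X)).
Hypothesis Dfgh : dist f g h.

Lemma htpy_exact1 t (y : htpy t Y) :
  htpym g y = 0 <-> exists x : htpy t X, htpym f x = y.
Proof. exact: dist_exact Dfgh. Qed.

Lemma htpy_exact2 t (z : htpy t Z) :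
  htpyd h z = 0 <-> exists y : htpy t Y, htpym g y = z.
Proof.
apply: iff_trans (dist_exact z ((dist_rot _ _ _).1 Dfgh)).
rewrite /htpyd; split=> [hz0 | ->]; last by rewrite comp0m desuspm0.
rewrite -[h \oc z]compm1 -(sph_suspK C t) compA.
by rewrite -[_ \oc sph_desusp C t]desuspmK hz0 suspm0 comp0m.
Qed.

Lemma htpy_exact3 t (x : htpy (t - 1) X) :
  htpym f x = 0 <-> exists z : htpy t Z, htpyd h z = x.
Proof.
have D2 := (dist_rot _ _ _).1 ((dist_rot _ _ _).1 Dfgh).
have E := dist_exact (suspm x \oc sph_susp C t) D2.
rewrite /htpym /htpyd; split=> [fx0 | [z <-]].
  have /E[z zE] : - suspm f \oc (suspm x \oc sph_susp C t) = 0.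
    by rewrite compA compNm -suspmM fx0 suspm0 oppr0 comp0m.
  exists z; rewrite zE -compA (sph_desuspK C) compm1; exact: suspmK.
have E' := dist_exact (h \oc z) D2.
have := E'.2 (ex_intro _ z erefl); rewrite compNm => /eqP.
rewrite oppr_eq0 => /eqP fhz0.
apply: (can_inj (@suspmK _ _ _)).
by rewrite suspmM desuspmK compA fhz0 comp0m suspm0.
Qed.

End LongExactSequence.

End HomotopyGroups.

(** * Towers *)

(** [tow_map T n] is Y_{n+1} -> Y_n. *)
Record tower (C : stable_category) := Tower {
  tow_obj :> int -> C;
  tow_map : forall n : int, hom (tow_obj (n + 1)) (tow_obj n)
}.

Section Towers.
Variables (C : stable_category) (T : tower C).

(** Homotopy limit: the fiber of (1 - shift) on the product of the Y_n. *)
Definition is_holim (L : C) (p : forall n, hom L (T n)) : Prop :=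
  exists (P : C) (pr : forall n, hom P (T n))
      (s : hom P P) (g : hom L P) (h : hom P (susp L)),
    [/\ is_product pr,
        forall n, pr n \oc s = pr n - tow_map T n \oc pr (n + 1),
        forall n, pr n \oc g = p n
      & dist g s h].

(** Homotopy colimit: the cofiber of (1 - shift) on the coproduct of the Y_n. *)
Definition is_hocolim (L : C) (q : forall n, hom (T n) L) : Prop :=
  exists (K : C) (inj : forall n, hom (T n) K)
      (s : hom K K) (g : hom K L) (h : hom L (susp K)),
    [/\ is_coproduct inj,
        forall n, s \oc inj (n + 1) = inj (n + 1) - inj n \oc tow_map T n,
        forall n, g \oc inj n = q n
      & dist s g h].

Definition ext_obj (Linf Lminf : C) (a : \bar int) : C :=
  match a with
  | n%:E%E => T n
  | +oo%E => Linf
  | -oo%E => Lminf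
  end.

(** The tower together with its homotopy limit and colimit, and all the
    (composite) maps Y_b -> Y_a for a <= b in [-oo, +oo]. *)
Record completion := Completion {
  lim_obj : C;
  colim_obj : C;
  cobj : \bar int -> C := ext_obj lim_obj colim_obj;
  cmap : forall a b : \bar int, (a <= b)%E -> hom (cobj b) (cobj a);
  cmap_id : forall a (h : (a <= a)%E), cmap h = idm (cobj a);
  cmap_comp : forall a b c
      (hab : (a <= b)%E) (hbc : (b <= c)%E) (hac : (a <= c)%E),
    cmap hab \oc cmap hbc = cmap hac;
  cmap_step : forall (n : int) (h : (n%:E <= (n + 1)%:E)%E),
    cmap h = tow_map T n;
  lim_proj : forall n : int, hom lim_obj (T n) :=
    fun n => cmap (leey n%:E);
  colim_inj : forall n : int, hom (T n) colim_obj :=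
    fun n => cmap (leNye n%:E);
  lim_holim : is_holim lim_proj;
  colim_hocolim : is_hocolim colim_inj
}.

(** [cof a b], meaningful for a <= b only, is the cofiber Y_a^b of Y_b -> Y_a.
    The maps [cofm] are the ones induced on cofibers by the commutative squares
    of maps of the tower, and [cofd a b c] below is Y_a^b -> susp Y_b^c. *)
Record cofibers (Y : completion) := Cofibers {
  cof : \bar int -> \bar int -> C;
  cofq : forall a b : \bar int, (a <= b)%E -> hom (cobj Y a) (cof a b);
  cofb : forall a b : \bar int, (a <= b)%E -> hom (cof a b) (susp (cobj Y b));
  cof_dist : forall (a b : \bar int) (h : (a <= b)%E),
    dist (cmap Y h) (cofq h) (cofb h);
  cofm : forall a b a' b' : \bar int,
    (a <= b)%E -> (a' <= b')%E -> (a' <= a)%E -> (b' <= b)%E ->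
    hom (cof a b) (cof a' b');
  cofm_id : forall a b (h h' : (a <= b)%E) (ha : (a <= a)%E) (hb : (b <= b)%E),
    cofm h h' ha hb = idm (cof a b);
  cofm_comp : forall a b a' b' a'' b''
      (h : (a <= b)%E) (h' : (a' <= b')%E) (h'' : (a'' <= b'')%E)
      (ha : (a' <= a)%E) (hb : (b' <= b)%E)
      (ha' : (a'' <= a')%E) (hb' : (b'' <= b')%E)
      (ha'' : (a'' <= a)%E) (hb'' : (b'' <= b)%E),
    cofm h' h'' ha' hb' \oc cofm h h' ha hb = cofm h h'' ha'' hb'';
  cofm_q : forall a b a' b' (h : (a <= b)%E) (h' : (a' <= b')%E)
      (ha : (a' <= a)%E) (hb : (b' <= b)%E),
    cofm h h' ha hb \oc cofq h = cofq h' \oc cmap Y ha;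
  cofm_b : forall a b a' b' (h : (a <= b)%E) (h' : (a' <= b')%E)
      (ha : (a' <= a)%E) (hb : (b' <= b)%E),
    cofb h' \oc cofm h h' ha hb = suspm (cmap Y hb) \oc cofb h;
  cofd : forall a b c : \bar int, (a <= b)%E -> (b <= c)%E ->
    hom (cof a b) (susp (cof b c)) :=
    fun a b c hab hbc => suspm (cofq hbc) \oc cofb hab;
  cofd_dist : forall a b c
      (hab : (a <= b)%E) (hbc : (b <= c)%E) (hac : (a <= c)%E),
    dist (cofm hbc hac hab (lexx c)) (cofm hac hab (lexx a) hbc)
         (cofd hab hbc)
}.

End Towers.

(** * Unrolled exact couples *)

(** Bigraded by the filtration n and the homotopical degree t.  The composite
    i^(m-n) : A_m -> A_n is part of the data as [ec_i], since A_(n + 1 + 1) and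
    A_(n + 2) are not the same type; i itself is [ec_i] for m = n + 1. *)
Record exact_couple := ExactCouple {
  ec_A : int -> int -> zmodType;
  ec_E : int -> int -> zmodType;
  ec_i : forall (t n m : int), n <= m -> {additive ec_A m t -> ec_A n t};
  ec_i_id : forall t n (h : n <= n) (a : ec_A n t), ec_i t h a = a;
  ec_i_comp : forall t n m l (h : n <= m) (h' : m <= l) (h'' : n <= l)
      (a : ec_A l t), ec_i t h (ec_i t h' a) = ec_i t h'' a;
  ec_j : forall t n : int, {additive ec_A n t -> ec_E n t};
  ec_k : forall t n : int, {additive ec_E n t -> ec_A (n + 1) (t - 1)};
  ec_exact_ij : forall t n (h : n <= n + 1) (a : ec_A n t),
    ec_j t n a = 0 <-> exists a' : ec_A (n + 1) t, ec_i t h a' = a;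
  ec_exact_jk : forall t n (e : ec_E n t),
    ec_k t n e = 0 <-> exists a : ec_A n t, ec_j t n a = e;
  ec_exact_ki : forall t n (h : n <= n + 1) (a : ec_A (n + 1) (t - 1)),
    ec_i (t - 1) h a = 0 <-> exists e : ec_E n t, ec_k t n e = a
}.

Section SpectralSequence.
Variable S : exact_couple.

(** In the sequel r >= 1, which is implied by the inequality h. *)

Definition cyclesZ (r n t : int) (x : ec_E S n t) : Prop :=
  exists (h : n + 1 <= n + r) (a : ec_A S (n + r) (t - 1)),
    ec_k S t n x = ec_i S (t - 1) h a.

Definition boundariesB (r n t : int) (x : ec_E S n t) : Prop :=
  exists (h : n - r + 1 <= n) (a : ec_A S n t),
    ec_i S t h a = 0 /\ ec_j S t n a = x.

(** d^r(x) = y in E^r = Z^r / B^r. *)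
Definition differential (r n t : int)
    (x : ec_E S n t) (y : ec_E S (n + r) (t - 1)) : Prop :=
  exists (x' : ec_E S n t) (y' : ec_E S (n + r) (t - 1))
      (h : n + 1 <= n + r) (a : ec_A S (n + r) (t - 1)),
    [/\ cyclesZ r x', boundariesB r (x - x'),
        cyclesZ r y', boundariesB r (y - y')
      & ec_k S t n x' = ec_i S (t - 1) h a /\ ec_j S (t - 1) (n + r) a = y'].

Definition is_cycle (s n t : int) (x : ec_E S n t) : Prop :=
  forall r : int, 1 <= r <= s -> differential x (0 : ec_E S (n + r) (t - 1)).

End SpectralSequence.

Arguments differential S r n {t} x y.
Arguments is_cycle S s n {t} x.

(** * The spectral sequences of a tower *)

Lemma le_efin (a b : int) : a <= b -> (a%:E <= b%:E)%E.
Proof. by rewrite lee_fin. Qed.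

Section TowerSpectralSequences.
Variables (C : stable_category) (T : tower C) (Y : completion T) (Q : cofibers Y).

Section Gathered.
Variables (phi : int -> int) (phi_incr : {homo phi : a b / a < b}).

Let phi_le (a b : int) : a <= b -> ((phi a)%:E <= (phi b)%:E)%E.
Proof. by move=> ab; apply: le_efin; exact: (ltW_homo phi_incr). Qed.

Let phi_le1 (n : int) : ((phi n)%:E <= (phi (n + 1))%:E)%E.
Proof. by apply: phi_le; rewrite lerDl. Qed.

Definition gathered_A (n t : int) : zmodType :=
  htpy t (cof Q (phi n)%:E +oo%E).

Definition gathered_E (n t : int) : zmodType :=
  htpy t (cof Q (phi n)%:E (phi (n + 1))%:E).

Definition gathered_i (t n m : int) (h : n <= m) :
    {additive gathered_A m t -> gathered_A n t} :=
  @htpym C t _ _ (cofm Q (leey _) (leey _) (phi_le h) (lexx +oo%E)).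

Definition gathered_j (t n : int) : {additive gathered_A n t -> gathered_E n t} :=
  @htpym C t _ _ (cofm Q (leey _) (phi_le1 n) (lexx _) (leey _)).

Definition gathered_k (t n : int) :
    {additive gathered_E n t -> gathered_A (n + 1) (t - 1)} :=
  @htpyd C t _ _ (cofd Q (phi_le1 n) (leey _)).

Lemma gathered_i_id t n (h : n <= n) (a : gathered_A n t) :
  gathered_i t h a = a.
Proof. by rewrite /gathered_i /= /htpym cofm_id comp1m. Qed.

Lemma gathered_i_comp t n m l (h : n <= m) (h' : m <= l) (h'' : n <= l)
    (a : gathered_A l t) :
  gathered_i t h (gathered_i t h' a) = gathered_i t h'' a.
Proof.
rewrite /gathered_i /= /htpym compA.
by rewrite (cofm_comp Q _ _ _ _ _ _ _ (phi_le h'') (lexx _)).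
Qed.

Let gathered_dist n (h : n <= n + 1) :
  dist (cofm Q (leey (phi (n + 1))%:E) (leey (phi n)%:E) (phi_le h) (lexx +oo%E))
       (cofm Q (leey (phi n)%:E) (phi_le1 n) (lexx _) (leey (phi (n + 1))%:E))
       (cofd Q (phi_le1 n) (leey (phi (n + 1))%:E)).
Proof. by rewrite (bool_irrelevance (phi_le h) (phi_le1 n)); exact: cofd_dist. Qed.

Lemma gathered_exact_ij t n (h : n <= n + 1) (a : gathered_A n t) :
  gathered_j t n a = 0 <->
  exists a' : gathered_A (n + 1) t, gathered_i t h a' = a.
Proof. exact: htpy_exact1 (gathered_dist h) _ _. Qed.

Lemma gathered_exact_jk t n (e : gathered_E n t) :
  gathered_k t n e = 0 <-> exists a : gathered_A n t, gathered_j t n a = e.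
Proof.
have h : n <= n + 1 by rewrite lerDl.
exact: htpy_exact2 (gathered_dist h) _ _.
Qed.

Lemma gathered_exact_ki t n (h : n <= n + 1) (a : gathered_A (n + 1) (t - 1)) :
  gathered_i (t - 1) h a = 0 <->
  exists e : gathered_E n t, gathered_k t n e = a.
Proof. exact: htpy_exact3 (gathered_dist h) _ _. Qed.

Definition gathered : exact_couple :=
  ExactCouple gathered_i_id gathered_i_comp
    gathered_exact_ij gathered_exact_jk gathered_exact_ki.

End Gathered.

Definition unrolled : exact_couple :=
  @gathered id (fun a b (h : a < b) => h).

(** Representation in the truncated spectral sequence (T_a^b): zt is an element
    of its A_n = pi_t(Y_n^b), with j(zt) = z, and zhat is the image of zt in its
    target pi_t(Y_a^b).  That z is an infinite cycle of (T_a^b) need not be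
    required separately, see [represents_cycle]. *)
Definition represents (a b n t : int) (han : a <= n) (hnb : n < b)
    (z : htpy t (cof Q n%:E (n + 1)%:E)) (zhat : htpy t (cof Q a%:E b%:E)) :
    Prop :=
  let hnb1 : n + 1 <= b := etrans (lezD1 n b) hnb in
  let hn1 : n <= n + 1 := etrans (lerDl n 1) ler01 in
  exists zt : htpy t (cof Q n%:E b%:E),
    htpym (cofm Q (le_efin (ltW hnb)) (le_efin hn1) (lexx _) (le_efin hnb1)) zt
      = z /\
    htpym (cofm Q (le_efin (ltW hnb)) (le_efin (le_trans han (ltW hnb)))
             (le_efin han) (lexx _)) zt
      = zhat.

Lemma represents_cycle a b n t (han : a <= n) (hnb : n < b)
    (z : htpy t (cof Q n%:E (n + 1)%:E)) (zhat : htpy t (cof Q a%:E b%:E))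
    (h : (n%:E <= (n + 1)%:E)%E) (h' : ((n + 1)%:E <= b%:E)%E) :
  represents han hnb z zhat -> htpyd (cofd Q h h') z = 0.
Proof.
case=> zt [zE _]; set hnb' := le_efin (ltW hnb) in zE.
apply/(htpy_exact2 (cofd_dist Q h h' hnb')); exists zt.
by rewrite -zE; congr (htpym (cofm _ _ _ _ _) _); exact: bool_irrelevance.
Qed.

End TowerSpectralSequences.

(* Main.v *)
(** The differential [d^r x] vanishes exactly when [k x] lifts along [i] to
    filtration [n + r + 1], so both parts only compare boundaries in the groups
    pi_*(Y_p^oo).  If [zt] in pi_t(Y_n^p) maps to [xhat] and to [x], where
    [p = phi (N + 1)], then [k x] is the boundary of [zt], and its image in
    pi_(t-1)(Y_(n+1)^oo) is [k xhat].  Part 1 follows, and for part 2 it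
    suffices to find such a [zt] whose boundary is a prescribed lift of
    [k xhat] to pi_(t-1)(Y_p^oo). *)

Require Import Defs.
From mathcomp Require Import all_boot all_order all_algebra.
From mathcomp Require Import constructive_ereal.

Import Order.TTheory GRing.Theory Num.Theory.
Local Open Scope ring_scope.

Lemma ec_kj (S : exact_couple) (t n : int) (a : ec_A S n t) :
  ec_k S t n (ec_j S t n a) = 0.
Proof. by apply/ec_exact_jk; exists a. Qed.

(** [l] is only propositionally [n + r + 1], to avoid casts in the type of [b]. *)
Lemma differential0P {S : exact_couple} {r n t l : int} (x : ec_E S n t)
    (h : n + 1 <= l) : 1 <= r -> l = n + r + 1 ->
  differential S r n x 0 <->
  exists b : ec_A S l (t - 1), ec_k S t n x = ec_i S (t - 1) h b.
Proof.
move=> r1 le; subst l.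
have h1 : n + 1 <= n + r by rewrite lerD2l.
have h2 : n + r <= n + r + 1 by rewrite lerDl.
split; last first.
  (* Pushing [b] one step down makes [j a = 0] by exactness, so [x] and [0] serve as their own
     representatives. *)
  case=> b kx; pose a := ec_i S (t - 1) h2 b.
  have kxa : ec_k S t n x = ec_i S (t - 1) h1 a by rewrite kx ec_i_comp.
  have hB s : s - r + 1 <= s by rewrite -addrA gerDl addrC subr_le0.
  exists x, 0, h1, a; split.
  - by exists h1, a.
  - by exists (hB n), 0; rewrite subrr !raddf0.
  - have hk : n + r + 1 <= n + r + r by rewrite lerD2l.
    by exists hk, 0; rewrite !raddf0.
  - by exists (hB (n + r)), 0; rewrite subrr !raddf0.
  - by split=> //; apply/ec_exact_ij; exists b.
case=> x' [y' [h' [a [_ [_ [e [_ ex]]] _ [hc [c [ic jc]]] [kx' ja]]]]].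
(* As [y'] is a boundary, [j c = - j a] for some [c] that dies in filtration
   [n + r - r + 1 = n + 1]. Adding [c] to [a] makes it lift to [b] without changing its image
   there. *)
have /(ec_exact_ij h2)[b ib] : ec_j S _ _ (a + c) = 0.
  by rewrite raddfD /= ja jc sub0r subrr.
exists b; transitivity (ec_k S t n x').
  (* [x - x'] is a boundary [j e], which [k] kills. *)
  by apply/eqP; rewrite -subr_eq0 -raddfB -ex /= ec_kj.
have hn : n + 1 <= n + r - r + 1 by rewrite addrK.
rewrite kx' -(ec_i_comp h1 h2) ib raddfD /=.
rewrite -(ec_i_comp hn hc h1 c) ic raddf0 addr0.
by congr (ec_i _ _ _ _); exact: bool_irrelevance.
Qed.

Lemma htpyd_suspm (C : stable_category) (t : int) (X X' Z : C)
    (f : Defs.hom X X') (h : Defs.hom Z (susp X)) (z : htpy t Z) :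
  htpyd (suspm f \oc h) z = htpym f (htpyd h z).
Proof.
apply: (can_inj (@suspmK _ _ _)).
by rewrite /htpyd /htpym suspmM !desuspmK !Defs.compA.
Qed.

Lemma htpyd_htpym (C : stable_category) (t : int) (X Z Z' : C)
    (h : Defs.hom Z' (susp X)) (f : Defs.hom Z Z') (z : htpy t Z) :
  htpyd h (htpym f z) = htpyd (h \oc f) z.
Proof. by rewrite /htpyd /htpym Defs.compA. Qed.

Section Cofibers.
Context {C : stable_category} {T : tower C} {Y : completion T}
  {Q : cofibers Y}.

(** Paste the square [cofm_b] with the suspension of the square [cofm_q]. *)
Lemma cofd_nat {a b c a' b' c' : \bar int}
    (hab : (a <= b)%E) (hbc : (b <= c)%E)
    (hab' : (a' <= b')%E) (hbc' : (b' <= c')%E)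
    (ha : (a' <= a)%E) (hb : (b' <= b)%E) (hc : (c' <= c)%E) :
  cofd Q hab' hbc' \oc cofm Q hab hab' ha hb =
  suspm (cofm Q hbc hbc' hb hc) \oc cofd Q hab hbc.
Proof. by rewrite /cofd -Defs.compA cofm_b !Defs.compA -!suspmM cofm_q. Qed.

(** [hab'] and [hab''] allow for distinct opaque proofs in [cofd] and [cofm]. *)
Lemma htpyd_cofd_nat {a b c a' b' c' : \bar int}
    (hab : (a <= b)%E) (hbc : (b <= c)%E)
    (hab' hab'' : (a' <= b')%E) (hbc' : (b' <= c')%E)
    (ha : (a' <= a)%E) (hb : (b' <= b)%E) (hc : (c' <= c)%E)
    {t : int} (z : htpy t (cof Q a b)) :
  htpyd (cofd Q hab'' hbc') (htpym (cofm Q hab hab' ha hb) z) =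
  htpym (cofm Q hbc hbc' hb hc) (htpyd (cofd Q hab hbc) z).
Proof.
rewrite (bool_irrelevance hab'' hab') htpyd_htpym.
by rewrite (cofd_nat _ hbc _ _ _ _ hc) htpyd_suspm.
Qed.

Lemma htpym_cofm_id {a b : \bar int} (h h' : (a <= b)%E)
    (ha : (a <= a)%E) (hb : (b <= b)%E) {t : int} (z : htpy t (cof Q a b)) :
  htpym (cofm Q h h' ha hb) z = z.
Proof. by rewrite /htpym cofm_id comp1m. Qed.

Lemma htpym_cofm_comp {a b a' b' a'' b'' : \bar int}
    (h : (a <= b)%E) (h' : (a' <= b')%E) (h'' : (a'' <= b'')%E)
    (ha : (a' <= a)%E) (hb : (b' <= b)%E)
    (ha' : (a'' <= a')%E) (hb' : (b'' <= b')%E)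
    (ha'' : (a'' <= a)%E) (hb'' : (b'' <= b)%E)
    {t : int} (z : htpy t (cof Q a b)) :
  htpym (cofm Q h' h'' ha' hb') (htpym (cofm Q h h' ha hb) z) =
  htpym (cofm Q h h'' ha'' hb'') z.
Proof. by rewrite /htpym Defs.compA cofm_comp. Qed.

(** A diagram chase: a first preimage [w] of [b] under the boundary is corrected
    by the image of a class of pi_t(Y_n^c), whose boundary is zero. *)
Lemma lift_boundary {n n1 p c : \bar int}
    (hn1 : (n <= n1)%E) (hn1p : (n1 <= p)%E) (hnp : (n <= p)%E)
    (hpc : (p <= c)%E) (hn1c : (n1 <= c)%E) (hnc : (n <= c)%E)
    {t : int} (z : htpy t (cof Q n n1)) (b : htpy (t - 1) (cof Q p c)) :
  htpyd (cofd Q hn1 hn1c) z = htpym (cofm Q hpc hn1c hn1p (lexx c)) b ->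
  exists zt : htpy t (cof Q n p),
    htpym (cofm Q hnp hn1 (lexx n) hn1p) zt = z /\
    htpyd (cofd Q hnp hpc) zt = b.
Proof.
move=> kz.
have D1 := cofd_dist Q hn1 hn1c hnc.
have Dp := cofd_dist Q hnp hpc hnc.
(* The map to $Y_n^c$ factors through $Y_{n1}^c$, where [b] becomes the boundary of [z]. *)
have /(htpy_exact3 Dp)[w dw] : htpym (cofm Q hpc hnc hnp (lexx c)) b = 0.
  rewrite -(htpym_cofm_comp hpc hn1c hnc hn1p (lexx c) hn1 (lexx c)) -kz.
  by apply/(htpy_exact3 D1); exists z.
pose w1 := htpym (cofm Q hnp hn1 (lexx n) hn1p) w.
have /(htpy_exact2 D1)[e je] : htpyd (cofd Q hn1 hn1c) (z - w1) = 0.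
  rewrite raddfB /= /w1 (htpyd_cofd_nat _ hpc _ _ _ _ _ (lexx c)).
  by rewrite dw kz subrr.
exists (w + htpym (cofm Q hnc hnp (lexx n) hpc) e).
rewrite !raddfD /= -/w1 dw; split.
  rewrite (htpym_cofm_comp _ _ _ _ _ _ _ (lexx n) hn1c) je.
  by rewrite addrC subrK.
by rewrite (_ : htpyd _ _ = 0) ?addr0 //; apply/(htpy_exact2 Dp); exists e.
Qed.

End Cofibers.

Theorem theorem4p14 (C : stable_category) (T : tower C) (Y : completion T)
    (Q : cofibers Y) (phi : int -> int) (phi_incr : {homo phi : a b / a < b}) :
  (forall (N M : int), N < M ->
   forall (t : int) (x : htpy t (cof Q (phi N)%:E (phi (N + 1))%:E)),
     is_cycle (gathered Q phi_incr) (M - N) N x ->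
   forall (n : int) (hNn : phi N <= n) (hnN : n < phi (N + 1))
     (xhat : htpy t (cof Q n%:E (n + 1)%:E)),
     represents hNn hnN xhat x ->
   forall m : int, n < m < phi (M + 1) ->
     differential (unrolled Q) (m - n) n xhat 0)
  /\
  (forall (N n m : int) (hNn : phi N <= n) (hnN : n < phi (N + 1)),
     phi (N + 1) < m ->
   forall (t : int) (xhat : htpy t (cof Q n%:E (n + 1)%:E)),
     is_cycle (unrolled Q) (m - n) n xhat ->
   exists x : htpy t (cof Q (phi N)%:E (phi (N + 1))%:E),
     represents hNn hnN xhat x /\
     forall M : int, phi (N + 1) < phi (M + 1) <= m ->
       is_cycle (gathered Q phi_incr) (M - N) N x).
Proof.
have phile a b : a <= b -> phi a <= phi b by exact: ltW_homo.
split.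
  move=> N M NM t x cx n hNn hnN xhat [zt [zE xE]] m /andP[nm mM].
  have r1 : 1 <= M - N by rewrite -gtz0_ge1 subr_gt0.
  have hM : N + 1 <= M + 1 by rewrite lerD2r ltW.
  have eM : M + 1 = N + (M - N) + 1 by rewrite [N + _]addrC subrK.
  have dx : differential (gathered Q phi_incr) (M - N) N x 0.
    by apply: cx; rewrite r1 lexx.
  have [b kx] := (differential0P (S := gathered Q phi_incr) x hM r1 eM).1 dx.
  have hm : n + 1 <= m + 1 by rewrite lerD2r ltW.
  have em : m + 1 = n + (m - n) + 1 by rewrite [n + _]addrC subrK.
  have s1 : 1 <= m - n by rewrite -gtz0_ge1 subr_gt0.
  apply/(differential0P _ hm s1 em).
  (* The strict bound [m < phi (M + 1)] is what lets [b] be pushed down to filtration [m + 1]. *)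
  have hmM : ((m + 1)%:E <= (phi (M + 1))%:E)%E by rewrite lee_fin lezD1.
  exists (htpym (cofm Q (leey _) (leey _) hmM (lexx _)) b).
  move: kx; rewrite -xE -zE /= /gathered_k /gathered_i /=.
  (* Both [k x] and [k xhat] become images of the boundary of [zt], the former under an identity
     map. *)
  rewrite !(htpyd_cofd_nat _ (leey _) _ _ _ _ _ (lexx _)).
  rewrite htpym_cofm_id => ->.
  have hnM : ((n + 1)%:E <= (phi (M + 1))%:E)%E.
    by rewrite (le_trans _ hmM) // lee_fin.
  by rewrite !(htpym_cofm_comp _ _ _ _ _ _ _ hnM (lexx _)).
move=> N n m hNn hnN pm t xhat cx.
have nm := lt_trans hnN pm.
have s1 : 1 <= m - n by rewrite -gtz0_ge1 subr_gt0.
have hm : n + 1 <= m + 1 by rewrite lerD2r ltW.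
have em : m + 1 = n + (m - n) + 1 by rewrite [n + _]addrC subrK.
have dx : differential (unrolled Q) (m - n) n xhat 0.
  by apply: cx; rewrite s1 lexx.
have [b kx] := (differential0P (S := unrolled Q) xhat hm s1 em).1 dx.
have hpm : ((phi (N + 1))%:E <= (m + 1)%:E)%E.
  by rewrite lee_fin (le_trans (ltW pm)) // lerDl.
pose bp := htpym (cofm Q (leey _) (leey _) hpm (lexx _)) b.
have hn1 : n <= n + 1 := etrans (lerDl n 1) ler01.
have hnb1 : n + 1 <= phi (N + 1) := etrans (lezD1 n (phi (N + 1))) hnN.
have [|zt [ztx dzt]] := lift_boundary (le_efin hn1)
  (le_efin hnb1) (le_efin (ltW hnN)) (leey _) (leey _) (leey _) xhat bp.
  have hnm : ((n + 1)%:E <= (m + 1)%:E)%E by rewrite lee_fin.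
  rewrite (htpym_cofm_comp _ _ _ _ _ _ _ hnm (lexx _)).
  (* This is [kx] up to the proofs of the inequalities. *)
  etransitivity; last (etransitivity; first exact: kx).
    by congr (htpyd (cofd _ _ _) _); exact: bool_irrelevance.
  by congr (htpym (cofm _ _ _ _ _) _); exact: bool_irrelevance.
exists (htpym (cofm Q (le_efin (ltW hnN)) (le_efin (le_trans hNn (ltW hnN)))
             (le_efin hNn) (lexx _)) zt); split.
  exists zt; split=> //; rewrite -[RHS]ztx.
  by congr (htpym (cofm _ _ _ _ _) _); exact: bool_irrelevance.
move=> M /andP[_ Mm] r /andP[r1 rM].
have hr : N + 1 <= N + r + 1 by rewrite lerD2r lerDl (le_trans _ r1).
apply/(differential0P _ hr r1 erefl).
(* Since [phi (N + r + 1) <= phi (M + 1) <= m], the same [b] in filtration [m + 1] yields the lift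
   of [k x] for every [M] and [r]. *)
have hrM : phi (N + r + 1) <= phi (M + 1).
  by rewrite phile // lerD2r addrC -lerBrDr.
have hrm : ((phi (N + r + 1))%:E <= (m + 1)%:E)%E.
  by rewrite lee_fin (le_trans hrM) // (le_trans Mm) // lerDl.
exists (htpym (cofm Q (leey _) (leey _) hrm (lexx _)) b).
rewrite /= /gathered_k /gathered_i /=.
rewrite (htpyd_cofd_nat _ (leey _) _ _ _ _ _ (lexx _)) htpym_cofm_id.
rewrite dzt (htpym_cofm_comp _ _ _ _ _ _ _ hpm (lexx _)).
by congr (htpym (cofm _ _ _ _ _) _); exact: bool_irrelevance.
Qed.
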